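(* For every binary stiffened-gas mixture state (with all quantities as defined in the context), set $\Delta_*:=p_{*2}-p_{*1}$. Then $$b=p_+ + p_-,\qquad c=-p_+p_-\geq 0,$$ where $$p_+=R\rho\theta-\langle\alpha_kp_{*k}\rangle>0,\qquad p_-=-\Big(\alpha_1p_{*2}+\alpha_2p_{*1}+\frac{\alpha_1\alpha_2}{c_V\rho\theta}\Delta_*^2\Big)\leq 0.$$ Consequently, $d=b^2+4c>0$, and thus these $p_\pm$ coincide with the roots $\tfrac12(b\pm\sqrt d)$ of the quadratic equation $p^2-bp-c=0$.
   Context: $\langle\cdot\rangle$ denotes summation over $k=1,2$. Physical constants for $k=1,2$: $c_{Vk}>0$, $\gamma_k>1$, $R_k=(\gamma_k-1)c_{Vk}>0$, $p_{*k}\geq 0$, $\varepsilon_{0k}\in\mathbb{R}$. A binary stiffened-gas mixture state consists of component densities $r_k>0$, volume fractions $0<\alpha_k<1$ ($k=1,2$) and a temperature $\theta>0$ such that $\alpha_1+\alpha_2=1$ and the component pressures $p_k=R_kr_k\theta-p_{*k}$ are equal to a common pressure: $p=p_1=p_2>0$. The component specific internal energies are $\varepsilon_k=c_{Vk}\theta+p_{*k}/r_k+\varepsilon_{0k}$. Put $\rho_k=\alpha_kr_k$, $\rho=\langle\rho_k\rangle$, and define $\varepsilon,\varepsilon_0,R,c_V,\gamma$ by $\rho\varepsilon=\langle\rho_k\varepsilon_k\rangle$, $\rho\varepsilon_0=\langle\rho_k\varepsilon_{0k}\rangle$, $\rho R=\langle R_k\rho_k\rangle$, $\rho c_V=\langle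 c_{Vk}\rho_k\rangle$, $\gamma=R/c_V+1$. Put $\sigma^{(k)}=\dfrac{R_k\rho_k}{c_V\rho}$ and $$b=\langle\sigma^{(k)}(\rho(\varepsilon-\varepsilon_0)-p_{*k})-p_{*k}\rangle,\qquad c=(\sigma^{(1)}p_{*2}+\sigma^{(2)}p_{*1})\rho(\varepsilon-\varepsilon_0)-\gamma p_{*1}p_{*2},\qquad d=b^2+4c.$$ The common pressure $p$ satisfies the quadratic equation $p^2-bp-c=0$. *)

(* Defs.v *)
From mathcomp Require Import all_boot all_order all_algebra.

Set Implicit Arguments.
Unset Strict Implicit.
Unset Printing Implicit Defensive.

Import Order.TTheory GRing.Theory Num.Theory.
Local Open Scope ring_scope.

(* The two components are indexed by 'I_2, so that the bracket < . > is
   \sum_(k < 2); the components written 1 and 2 are k1 and k2. *)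
Notation k1 := (@ord0 1).
Notation k2 := (@ord_max 1).

Record gas_constants (F : rcfType) := GasConstants {
  cVk : 'I_2 -> F;
  gammak : 'I_2 -> F;
  pstar : 'I_2 -> F;
  eps0k : 'I_2 -> F;
  cVk_gt0 : forall k, 0 < cVk k;
  gammak_gt1 : forall k, 1 < gammak k;
  pstar_ge0 : forall k, 0 <= pstar k
}.

Definition Rk (F : rcfType) (G : gas_constants F) (k : 'I_2) : F :=
  (gammak G k - 1) * cVk G k.

Record mixture_state (F : rcfType) (G : gas_constants F) := MixtureState {
  rk : 'I_2 -> F;
  alphak : 'I_2 -> F;
  theta : F;
  press : F;
  rk_gt0 : forall k, 0 < rk k;
  alphak_gt0 : forall k, 0 < alphak k;
  alphak_lt1 : forall k, alphak k < 1;
  alphak_sum : alphak k1 + alphak k2 = 1;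
  theta_gt0 : 0 < theta;
  press_eq : forall k, Rk G k * rk k * theta - pstar G k = press;
  press_gt0 : 0 < press
}.

Section MixtureQuantities.
Variables (F : rcfType) (G : gas_constants F) (s : mixture_state G).

Definition epsk (k : 'I_2) : F :=
  cVk G k * theta s + pstar G k / rk s k + eps0k G k.

Definition rhok (k : 'I_2) : F := alphak s k * rk s k.

Definition rho : F := \sum_(k < 2) rhok k.

(* The mixture quantities eps, eps0, R, cV are given by relations of the form
   rho * q = < q_k rho_k >; they are solved for q here, as rho > 0. *)
Definition eps : F := (\sum_(k < 2) rhok k * epsk k) / rho.

Definition eps0 : F := (\sum_(k < 2) rhok k * eps0k G k) / rho.

Definition Rmix : F := (\sum_(k < 2) Rk G k * rhok k) / rho.

Definition cV : F := (\sum_(k < 2) cVk G k * rhok k) / rho.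

Definition gamma : F := Rmix / cV + 1.

Definition sigma (k : 'I_2) : F := Rk G k * rhok k / (cV * rho).

Definition bcoef : F :=
  \sum_(k < 2) (sigma k * (rho * (eps - eps0) - pstar G k) - pstar G k).

Definition ccoef : F :=
  (sigma k1 * pstar G k2 + sigma k2 * pstar G k1) * (rho * (eps - eps0))
  - gamma * pstar G k1 * pstar G k2.

Definition dcoef : F := bcoef ^+ 2 + 4%:R * ccoef.

Definition Delta_star : F := pstar G k2 - pstar G k1.

Definition p_plus : F :=
  Rmix * rho * theta s - \sum_(k < 2) alphak s k * pstar G k.

Definition p_minus : F :=
  - (alphak s k1 * pstar G k2 + alphak s k2 * pstar G k1
     + alphak s k1 * alphak s k2 / (cV * rho * theta s) * Delta_star ^+ 2).

End MixtureQuantities.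

(* Main.v *)
Require Import Defs.
From mathcomp Require Import all_boot all_order all_algebra.
From mathcomp Require Import ring.
Import Order.TTheory GRing.Theory Num.Theory.
Local Open Scope ring_scope.

(** The idea is that [p_plus] is the common pressure [press] in disguise:
averaging the two laws [Rk * rk * theta - pstar = press] with the weights
[alphak] gives [p_plus = press] ([p_plus_press]), which is positive by
hypothesis, while [p_minus] is visibly nonpositive.

The laws also give [Rk * rhok * theta = alphak * (press + pstar)].  Hence all
that enters [bcoef] and [ccoef] can be written with the volume fractions, the
[pstar], the pressure and the single positive quantity
[m = cV * rho * theta]:
  [sigma k = alphak k * (press + pstar k) / m]  ([sigma_press]),
  [rho * (eps - eps0) = m + < alphak pstar >]   ([rho_internal_energy]),
  [gamma = 1 + sigma k1 + sigma k2]             ([gamma_sigma]).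
With [alphak k1 + alphak k2 = 1], the identities for [bcoef] and [ccoef]
become identities of rational functions, in which the [Delta_star ^+ 2] term
comes from the variance of [pstar] under the weights [alphak]:
  [< alphak pstar^2 > - < alphak pstar >^2
     = alphak k1 * alphak k2 * Delta_star ^+ 2].

The rest is Vieta: a quadratic whose coefficients are the sum and minus the
product of [p_plus > p_minus] has discriminant [(p_plus - p_minus) ^+ 2 > 0]
and exactly these two roots. *)

Lemma sum_I2 (V : nmodType) (f : 'I_2 -> V) : \sum_(k < 2) f k = f k1 + f k2.
Proof.
rewrite big_ord_recr big_ord1; congr (f _ + _).
exact/val_inj.
Qed.

Lemma vieta_sqrt_discr (F : rcfType) (u v : F) : v < u ->
  Num.sqrt ((u + v) ^+ 2 + 4%:R * - (u * v)) = u - v.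
Proof.
move=> vu; have -> : (u + v) ^+ 2 + 4%:R * - (u * v) = (u - v) ^+ 2 by ring.
by rewrite sqrtr_sqr ger0_norm // subr_ge0 ltW.
Qed.

Lemma vieta_roots (F : idomainType) (u v x : F) :
  x ^+ 2 - (u + v) * x - - (u * v) = 0 <-> x = u \/ x = v.
Proof.
have -> : x ^+ 2 - (u + v) * x - - (u * v) = (x - u) * (x - v) by ring.
split=> [/eqP | [] ->]; last 2 first.
- by rewrite subrr mul0r.
- by rewrite subrr mulr0.
by rewrite mulf_eq0 !subr_eq0 => /orP [] /eqP; [left | right].
Qed.

Section MixtureInTermsOfPressure.
Variables (F : rcfType) (G : gas_constants F) (s : mixture_state G).

Lemma rhok_gt0 k : 0 < rhok s k.
Proof. by rewrite mulr_gt0 ?alphak_gt0 ?rk_gt0. Qed.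

Lemma rho_gt0 : 0 < rho s.
Proof. by rewrite /rho sum_I2 addr_gt0 ?rhok_gt0. Qed.

Lemma cV_rho : cV s * rho s = \sum_(k < 2) cVk G k * rhok s k.
Proof. by rewrite /cV divfK // gt_eqF ?rho_gt0. Qed.

Lemma cV_rho_gt0 : 0 < cV s * rho s.
Proof. by rewrite cV_rho sum_I2 addr_gt0 // mulr_gt0 ?cVk_gt0 ?rhok_gt0. Qed.

Lemma Rmix_rho : Rmix s * rho s = \sum_(k < 2) Rk G k * rhok s k.
Proof. by rewrite /Rmix divfK // gt_eqF ?rho_gt0. Qed.

Lemma thermal_energy_gt0 : 0 < cV s * rho s * theta s.
Proof. by rewrite mulr_gt0 ?cV_rho_gt0 ?theta_gt0. Qed.

Lemma Rk_rhok_theta k :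
  Rk G k * rhok s k * theta s = alphak s k * (press s + pstar G k).
Proof. by rewrite -(press_eq s k) /rhok; ring. Qed.

Lemma p_plus_press : p_plus s = press s.
Proof.
rewrite /p_plus Rmix_rho !sum_I2 mulrDl !Rk_rhok_theta.
rewrite -[RHS]mul1r -(alphak_sum s); ring.
Qed.

Lemma sigma_press k :
  sigma s k = alphak s k * (press s + pstar G k) / (cV s * rho s * theta s).
Proof.
have theta_neq0 : theta s != 0 by rewrite gt_eqF ?theta_gt0.
by rewrite -Rk_rhok_theta -mulf_div divff // mulr1.
Qed.

Lemma gamma_sigma : gamma s = 1 + sigma s k1 + sigma s k2.
Proof.
rewrite /sigma /gamma -addrA -mulrDl.
have := Rmix_rho; rewrite sum_I2 => <-; rewrite addrC.
by rewrite -[in RHS]mulf_div divff ?mulr1 // gt_eqF ?rho_gt0.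
Qed.

(** The terms [pstar / rk] of the internal energies, weighted by
[rhok = alphak * rk], lose their dependence on the densities. *)
Lemma rho_internal_energy :
  rho s * (eps s - eps0 s)
  = cV s * rho s * theta s + \sum_(k < 2) alphak s k * pstar G k.
Proof.
have rk_neq0 k : rk s k != 0 by rewrite gt_eqF ?rk_gt0.
rewrite /eps /eps0 -mulrBl mulrC divfK ?gt_eqF ?rho_gt0 // cV_rho.
rewrite !sum_I2 /epsk /rhok.
by field; rewrite !rk_neq0.
Qed.

Lemma alphak2 : alphak s k2 = 1 - alphak s k1.
Proof. by rewrite -(alphak_sum s) addrC addKr. Qed.

Lemma bcoef_sum : bcoef s = p_plus s + p_minus s.
Proof.
rewrite p_plus_press /bcoef /p_minus /Delta_star rho_internal_energy.
rewrite !sum_I2 !sigma_press alphak2.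
(* [cV] and [rho] occur only through [m], so [field] may treat [m] as an atom
   instead of expanding both into sums. *)
have := thermal_energy_gt0; set m := cV s * rho s * theta s => m_gt0.
by field; rewrite gt_eqF.
Qed.

Lemma ccoef_prod : ccoef s = - (p_plus s * p_minus s).
Proof.
rewrite p_plus_press /ccoef /p_minus /Delta_star rho_internal_energy.
rewrite gamma_sigma !sum_I2 !sigma_press alphak2.
have := thermal_energy_gt0; set m := cV s * rho s * theta s => m_gt0.
by field; rewrite gt_eqF.
Qed.

Lemma p_plus_gt0 : 0 < p_plus s.
Proof. by rewrite p_plus_press press_gt0. Qed.

Lemma p_minus_le0 : p_minus s <= 0.
Proof.
have a_ge0 k : 0 <= alphak s k by rewrite ltW ?alphak_gt0.
have m_ge0 := ltW thermal_energy_gt0.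
rewrite /p_minus oppr_le0 addr_ge0 //.
  by rewrite addr_ge0 // mulr_ge0 ?pstar_ge0.
by rewrite mulr_ge0 ?sqr_ge0 // divr_ge0 // mulr_ge0.
Qed.

End MixtureInTermsOfPressure.

Theorem proposition1 (F : rcfType) (G : gas_constants F) (s : mixture_state G) :
  [/\ bcoef s = p_plus s + p_minus s,
      ccoef s = - (p_plus s * p_minus s) /\ 0 <= ccoef s,
      0 < p_plus s /\ p_minus s <= 0,
      0 < dcoef s
    & [/\ p_plus s = (bcoef s + Num.sqrt (dcoef s)) / 2%:R,
          p_minus s = (bcoef s - Num.sqrt (dcoef s)) / 2%:R
        & forall x : F, x ^+ 2 - bcoef s * x - ccoef s = 0 <->
                        x = p_plus s \/ x = p_minus s]].
Proof.
have p_gt0 := p_plus_gt0 _ _ s; have q_le0 := p_minus_le0 _ _ s.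
have q_lt_p : p_minus s < p_plus s := le_lt_trans q_le0 p_gt0.
have sqrt_d : Num.sqrt (dcoef s) = p_plus s - p_minus s.
  by rewrite /dcoef bcoef_sum ccoef_prod vieta_sqrt_discr.
split=> //.
- exact: bcoef_sum.
- split; first exact: ccoef_prod.
  by rewrite ccoef_prod oppr_ge0 mulr_ge0_le0 // ltW.
- by rewrite -sqrtr_gt0 sqrt_d subr_gt0.
split.
- by rewrite sqrt_d bcoef_sum; field.
- by rewrite sqrt_d bcoef_sum; field.
by move=> x; rewrite bcoef_sum ccoef_prod; exact: vieta_roots.
Qed.
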